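(* The generatrix curve of the Enneper's surface of second kind, $u=v^3/3$, $v>0$, is the only spacelike curve (up to dilations and translations in the $u$-direction) in $\mathbb{L}^2$ with geometric linear momentum $\mathcal K(v)=v$ (and curvature $\kappa(v)=1/v^2$).
   Context: $\mathbb{L}^2=(\mathbb{R}^2,g=-dx^2+dy^2)$ is the Lorentz-Minkowski plane with rectangular coordinates $(x,y)$. A curve $\gamma=(x,y)$ is spacelike if $g(\gamma',\gamma')>0$ everywhere, and a spacelike curve is unit-speed if $g(\dot\gamma,\dot\gamma)=1$; the dot is the derivative with respect to the arc parameter $s$. For a spacelike unit-speed curve put $T=\dot\gamma=(\dot x,\dot y)$ and $N=(\dot y,\dot x)$; the (signed) curvature $\kappa$ is defined by $\dot T=\kappa N$, i.e. $\kappa=\ddot x\dot y-\dot x\ddot y$. Coordinates $(u,v)$ on $\mathbb{L}^2$ are defined by $u=y+x$, $v=y-x$. The geometric linear momentum (with respect to the lightlike geodesic $x=y$, the $u$-axis) of a unit-speed curve is $\mathcal K(s)=\dot u(s)$. The condition $\kappa(v)=1/v^2$ is considered with $v\neq 0$. The Enneper's surface of second kind (Kobayashi) is, up to dilations, the maximal rotation surface in $\mathbb{L}^3=(\mathbb{R}^3,-dx^2+dy^2+dz^2)$ with lightlike axis $(1,0,1)$ and generatrix curve $x=\lambda(-t+t^3/3)$, $z=\lambda(t+t^3/3)$, $\lambda>0$, in the $xz$-plane. Identifying the $xz$-plane with $\mathbb{L}^2$ (with $z$ in the role of $y$) and taking $\lambda=1/2$, this generatrix curve is $u=t^3/3$,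 $v=t$, i.e. $u=v^3/3$. *)

(* Defs.v *)
From Stdlib Require Import Reals Lra.
From Coquelicot Require Import Coquelicot.
Open Scope R_scope.

(* Points are pairs (x, y) of rectangular coordinates. *)
Definition L2 : Type := (R * R)%type.

Definition g (p q : L2) : R := - (fst p * fst q) + snd p * snd q.

Definition ucoord (p : L2) : R := snd p + fst p.
Definition vcoord (p : L2) : R := snd p - fst p.

Definition Ioo (a b : Rbar) (t : R) : Prop :=
  Rbar_lt a (Finite t) /\ Rbar_lt (Finite t) b.

Definition xcomp (gamma : R -> L2) (t : R) : R := fst (gamma t).
Definition ycomp (gamma : R -> L2) (t : R) : R := snd (gamma t).

Definition velocity (gamma : R -> L2) (t : R) : L2 :=
  (Derive (xcomp gamma) t, Derive (ycomp gamma) t).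

(* Curves are functions on R of which only the restriction to a nonempty,
   possibly unbounded, open interval matters.  Two derivatives is the
   regularity needed for the curvature to make sense. *)
Definition curve (gamma : R -> L2) (a b : Rbar) : Prop :=
  Rbar_lt a b /\
  forall t, Ioo a b t ->
    (ex_derive (xcomp gamma) t /\ ex_derive (Derive (xcomp gamma)) t) /\
    (ex_derive (ycomp gamma) t /\ ex_derive (Derive (ycomp gamma)) t).

Definition spacelike (gamma : R -> L2) (a b : Rbar) : Prop :=
  curve gamma a b /\
  forall t, Ioo a b t -> 0 < g (velocity gamma t) (velocity gamma t).

Definition unit_speed (gamma : R -> L2) (a b : Rbar) : Prop :=
  curve gamma a b /\
  forall s, Ioo a b s -> g (velocity gamma s) (velocity gamma s) = 1.

(* The next two are meant for unit-speed curves; the curvature is the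
   coefficient in T' = kappa N with T = (x', y') and N = (y', x'). *)
Definition momentum (gamma : R -> L2) (s : R) : R :=
  Derive (fun r => ucoord (gamma r)) s.

Definition curvature (gamma : R -> L2) (s : R) : R :=
  Derive (Derive (xcomp gamma)) s * Derive (ycomp gamma) s
  - Derive (xcomp gamma) s * Derive (Derive (ycomp gamma)) s.

Lemma Ioo_locally (a b : Rbar) (t : R) : Ioo a b t -> locally t (Ioo a b).
Proof.
intros [Ha Hb]; apply filter_and.
- exact (open_Rbar_gt' (Finite t) a Ha).
- exact (open_Rbar_lt' (Finite t) b Hb).
Qed.

Lemma unit_speed_frenet (gamma : R -> L2) (a b : Rbar) (s : R) :
  unit_speed gamma a b -> Ioo a b s ->
  velocity (velocity gamma) s
  = (curvature gamma s * Derive (ycomp gamma) s,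
     curvature gamma s * Derive (xcomp gamma) s).
Proof.
intros [[_ Hreg] Hunit] Hs.
destruct (Hreg s Hs) as [[_ Hx] [_ Hy]].
set (X := Derive (xcomp gamma)) in *.
set (Y := Derive (ycomp gamma)) in *.
assert (H1 : - (X s * X s) + Y s * Y s = 1) by exact (Hunit s Hs).
assert (H2 : - (2 * (Derive X s * X s)) + 2 * (Derive Y s * Y s) = 0).
{ transitivity (Derive (fun r => - (X r * X r) + Y r * Y r) s).
  - symmetry; apply is_derive_unique; auto_derive.
    + tauto.
    + change (Derive (fun r => X r) s) with (Derive X s).
      change (Derive (fun r => Y r) s) with (Derive Y s). ring.
  - rewrite (Derive_ext_loc _ (fun _ => 1)).
    + apply Derive_const.
    + exact (filter_imp _ _ Hunit (Ioo_locally a b s Hs)). }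
change ((Derive X s, Derive Y s)
        = (curvature gamma s * Y s, curvature gamma s * X s)).
unfold curvature; fold X Y.
assert (H3 : Derive Y s * Y s = Derive X s * X s) by lra.
f_equal.
- transitivity (Derive X s * (- (X s * X s) + Y s * Y s)); [rewrite H1; ring|].
  transitivity (Derive X s * Y s * Y s - X s * (Derive X s * X s)); [ring|].
  rewrite <- H3; ring.
- transitivity (Derive Y s * (- (X s * X s) + Y s * Y s)); [rewrite H1; ring|].
  transitivity ((Derive Y s * Y s) * Y s - Derive Y s * X s * X s); [ring|].
  rewrite H3; ring.
Qed.

(* sigma, on (c, d), is gamma, on (a, b), reparametrized by arc length with
   the orientation of gamma; reversing the orientation would change the sign
   of both the momentum and the curvature. *)
Definition arc_parametrization (gamma : R -> L2) (a b : Rbar)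
    (sigma : R -> L2) (c d : Rbar) : Prop :=
  unit_speed sigma c d /\
  exists phi : R -> R,
    (forall s, Ioo c d s ->
       Ioo a b (phi s) /\ ex_derive phi s /\ 0 < Derive phi s /\
       sigma s = gamma (phi s)) /\
    (forall t, Ioo a b t -> exists s, Ioo c d s /\ phi s = t).

Definition has_momentum (gamma : R -> L2) (a b : Rbar) (K : R -> R) : Prop :=
  exists (sigma : R -> L2) (c d : Rbar),
    arc_parametrization gamma a b sigma c d /\
    forall s, Ioo c d s -> momentum sigma s = K (vcoord (sigma s)).

Definition has_curvature (gamma : R -> L2) (a b : Rbar) (k : R -> R) : Prop :=
  exists (sigma : R -> L2) (c d : Rbar),
    arc_parametrization gamma a b sigma c d /\
    forall s, Ioo c d s -> curvature sigma s = k (vcoord (sigma s)).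

Definition dilate (lambda : R) (p : L2) : L2 :=
  (lambda * fst p, lambda * snd p).

(* The u-axis is the line x = y, directed by (1, 1). *)
Definition translate_u (h : R) (p : L2) : L2 := (fst p + h, snd p + h).

(* The ratio may be negative: the central symmetry of ratio -1 preserves the
   condition K(v) = v and exchanges the half-planes v > 0 and v < 0. *)
Definition arc_up_to_dilation_and_u_translation
    (gamma : R -> L2) (a b : Rbar) (delta : R -> L2) (c d : Rbar) : Prop :=
  exists lambda h : R, lambda <> 0 /\
    forall t, Ioo a b t ->
      exists tau, Ioo c d tau /\
        gamma t = translate_u h (dilate lambda (delta tau)).

(* Profile curve of Enneper's surface of second kind, the z-axis of the
   xz-plane being the y-axis of L2. *)
Definition enneper_profile (lambda t : R) : L2 :=
  (lambda * (- t + t ^ 3 / 3), lambda * (t + t ^ 3 / 3)).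

Definition enneper_generatrix : R -> L2 := enneper_profile (1 / 2).

Lemma enneper_generatrix_trace (p : L2) :
  (exists t, Ioo (Finite 0) p_infty t /\ p = enneper_generatrix t) <->
  0 < vcoord p /\ ucoord p = vcoord p ^ 3 / 3.
Proof.
destruct p as [x y].
unfold Ioo, ucoord, vcoord, enneper_generatrix, enneper_profile; simpl; split.
- intros [t [[Ht _] E]]; injection E as -> ->.
  split; [lra | field].
- intros [Hv Hu]; exists (y - x); split; [tauto|].
  f_equal; lra.
Qed.

(* Main.v *)
(** In the coordinates [u = y + x], [v = y - x] the metric is [du dv], so a
    unit-speed curve satisfies [u' v' = 1].  If moreover [u' = v], then
    [v v' = 1]: hence [v] never vanishes and keeps a constant sign, and
    [u - v^3/3] has derivative [v - v^2 v' = 0], so [u = v^3/3 + C].  The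
    constant is absorbed by a translation in the [u]-direction, and the branch
    [v < 0] is the image of the branch [v > 0] under the dilation of ratio [-1].
    Differentiating [u' = v] with the Frenet equations gives
    [kappa u' = v'], that is [kappa = 1/v^2].  The arc parameter of
    [u = v^3/3] itself is [v^2/2]. *)

Require Import Defs.
From Stdlib Require Import Reals Ranalysis5 Lra.
From Coquelicot Require Import Coquelicot.
Open Scope R_scope.

(** * Open intervals and constancy of sign *)

Lemma Ioo_convex (a b : Rbar) (r s t : R) :
  Ioo a b r -> Ioo a b t -> r <= s <= t -> Ioo a b s.
Proof.
unfold Ioo; destruct a, b; simpl; intros; intuition lra.
Qed.

Lemma Ioo_inhabited (a b : Rbar) : Rbar_lt a b -> exists t, Ioo a b t.
Proof.
unfold Ioo; destruct a as [a| |], b as [b| |]; simpl; intros H; try tauto.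
- exists ((a + b) / 2); lra.
- exists (a + 1); lra.
- exists (b - 1); lra.
- exists 0; tauto.
Qed.

(** By the intermediate value theorem, a change of sign would force a zero between [s0] and [s].
    [IVT_interv] wants the negative value at the left end, so [- f] is used when [s0 < s]. *)
Lemma nonvanishing_constant_sign (f : R -> R) (a b : Rbar) (s0 s : R) :
  (forall t, Ioo a b t -> continuity_pt f t /\ f t <> 0) ->
  Ioo a b s0 -> Ioo a b s -> 0 < f s0 -> 0 < f s.
Proof.
intros Hf H0 Hs Hpos.
destruct (Rtotal_order (f s) 0) as [Hneg|[Heq|Hgt]]; [exfalso| |exact Hgt].
2: { destruct (proj2 (Hf s Hs) Heq). }
destruct (Rtotal_order s s0) as [Hlt|[->|Hlt]].
- destruct (IVT_interv f s s0) as [z [Hz Ez]]; auto.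
  { intros t Ht; apply Hf; exact (Ioo_convex a b s t s0 Hs H0 Ht). }
  exact (proj2 (Hf z (Ioo_convex a b s z s0 Hs H0 Hz)) Ez).
- lra.
- destruct (IVT_interv (fun t => - f t) s0 s) as [z [Hz Ez]]; try lra.
  { intros t Ht; apply continuity_pt_opp, Hf.
    exact (Ioo_convex a b s0 t s H0 Hs Ht). }
  apply (proj2 (Hf z (Ioo_convex a b s0 z s H0 Hs Hz))); lra.
Qed.

(** * Unit-speed curves whose momentum is [v] *)

Section UnitSpeed.

Variables (sigma : R -> L2) (c d : Rbar).
Hypothesis Hsigma : unit_speed sigma c d.

Let u (s : R) : R := ucoord (sigma s).
Let v (s : R) : R := vcoord (sigma s).

Lemma is_derive_ucoord (s : R) : Ioo c d s ->
  is_derive u s (Derive (ycomp sigma) s + Derive (xcomp sigma) s).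
Proof.
intros Hs; destruct (proj2 (proj1 Hsigma) s Hs) as [[Hx _] [Hy _]].
apply (is_derive_plus (ycomp sigma) (xcomp sigma)); now apply Derive_correct.
Qed.

Lemma is_derive_vcoord (s : R) : Ioo c d s ->
  is_derive v s (Derive (ycomp sigma) s - Derive (xcomp sigma) s).
Proof.
intros Hs; destruct (proj2 (proj1 Hsigma) s Hs) as [[Hx _] [Hy _]].
apply (is_derive_minus (ycomp sigma) (xcomp sigma)); now apply Derive_correct.
Qed.

Lemma momentum_unit_speed (s : R) : Ioo c d s ->
  momentum sigma s = Derive (ycomp sigma) s + Derive (xcomp sigma) s.
Proof. intros Hs; exact (is_derive_unique _ _ _ (is_derive_ucoord s Hs)). Qed.

Hypothesis Hmom : forall s, Ioo c d s -> momentum sigma s = v s.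

(** Unit speed factors as [(y' + x') (y' - x') = 1]. The first factor is the momentum, so it cannot
    vanish and the second is its inverse. *)
Lemma momentum_vcoord_velocity (s : R) : Ioo c d s ->
  v s <> 0 /\
  Derive (ycomp sigma) s + Derive (xcomp sigma) s = v s /\
  Derive (ycomp sigma) s - Derive (xcomp sigma) s = / v s.
Proof.
intros Hs.
assert (HK := Hmom s Hs); rewrite (momentum_unit_speed s Hs) in HK.
assert (H1 := proj2 Hsigma s Hs); unfold g, velocity in H1; simpl in H1.
assert (H2 : v s * (Derive (ycomp sigma) s - Derive (xcomp sigma) s) = 1).
{ rewrite <- HK, <- H1; ring. }
assert (Hv : v s <> 0) by (intros E; rewrite E in H2; lra).
split; [exact Hv|split; [exact HK|]].
apply (Rmult_eq_reg_l (v s)); [|exact Hv].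
now rewrite H2, Rinv_r.
Qed.

Lemma momentum_vcoord_curvature (s : R) : Ioo c d s ->
  curvature sigma s = 1 / v s ^ 2.
Proof.
intros Hs.
destruct (momentum_vcoord_velocity s Hs) as [Hv [HP HM]].
destruct (proj2 (proj1 Hsigma) s Hs) as [[_ HX] [_ HY]].
assert (HF := unit_speed_frenet sigma c d s Hsigma Hs).
injection HF as FX FY.
change (Derive (Derive (xcomp sigma)) s
        = curvature sigma s * Derive (ycomp sigma) s) in FX.
change (Derive (Derive (ycomp sigma)) s
        = curvature sigma s * Derive (xcomp sigma) s) in FY.
(* This is [u'' = v']: the identity [u' = v] holds on a neighbourhood of [s], so it may be
   differentiated there. *)
assert (E : Derive (Derive (ycomp sigma)) s + Derive (Derive (xcomp sigma)) s
            = / v s).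
{ rewrite <- HM, <- (is_derive_unique _ _ _ (is_derive_vcoord s Hs)).
  rewrite <- (Derive_plus _ _ _ HY HX).
  apply Derive_ext_loc.
  apply (filter_imp (Ioo c d)); [|exact (Ioo_locally c d s Hs)].
  intros t Ht; exact (proj1 (proj2 (momentum_vcoord_velocity t Ht))). }
(* The sum of the two Frenet components is [u'' = kappa u'], with [u' = v]. *)
rewrite FX, FY in E.
assert (E' : curvature sigma s * v s = / v s) by (rewrite <- E, <- HP; ring).
apply (Rmult_eq_reg_r (v s)); [|exact Hv].
rewrite E'; field; exact Hv.
Qed.

(** Multiplying by the constant [v s0] treats both signs at once: the product never vanishes and is
    a positive square at [s0]. *)
Lemma momentum_vcoord_constant_sign (s0 s : R) : Ioo c d s0 -> Ioo c d s ->
  0 < v s0 * v s.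
Proof.
intros H0 Hs.
apply (nonvanishing_constant_sign (fun t => v s0 * v t) c d s0 s); auto.
- intros t Ht; split.
  + apply continuity_pt_scal, derivable_continuous_pt.
    exists (Derive (ycomp sigma) t - Derive (xcomp sigma) t).
    apply is_derive_Reals; exact (is_derive_vcoord t Ht).
  + apply Rmult_integral_contrapositive_currified;
      now apply momentum_vcoord_velocity.
- assert (Hv := proj1 (momentum_vcoord_velocity s0 H0)).
  exact (Rsqr_pos_lt _ Hv).
Qed.

Lemma momentum_vcoord_cubic_constant (r s : R) : Ioo c d r -> Ioo c d s ->
  u r - v r ^ 3 / 3 = u s - v s ^ 3 / 3.
Proof.
assert (Hder : forall t, Ioo c d t ->
          is_derive (fun t => u t - v t ^ 3 / 3) t 0).
{ intros t Ht.
  destruct (momentum_vcoord_velocity t Ht) as [Hv [HP HM]].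
  assert (Hu' := is_derive_ucoord t Ht); rewrite HP in Hu'.
  assert (Hv' := is_derive_vcoord t Ht); rewrite HM in Hv'.
  auto_derive.
  - repeat split; eexists; eassumption.
  - change (Derive (fun x : R => u x) t) with (Derive u t).
    change (Derive (fun x : R => v x) t) with (Derive v t).
    rewrite (is_derive_unique u _ _ Hu'), (is_derive_unique v _ _ Hv').
    field; exact Hv. }
assert (Hlt : forall p q, Ioo c d p -> Ioo c d q -> p < q ->
          u p - v p ^ 3 / 3 = u q - v q ^ 3 / 3).
{ intros p q Hp Hq Hpq.
  apply (eq_is_derive (fun t => u t - v t ^ 3 / 3)); [|exact Hpq].
  intros t Ht; exact (Hder t (Ioo_convex c d p t q Hp Hq Ht)). }
(* [Hlt] compares the endpoints of a nondegenerate interval, hence the cases on the order of [r] and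
   [s]. *)
intros Hr Hs; destruct (Rtotal_order r s) as [H|[->|H]]; auto.
symmetry; auto.
Qed.

Lemma momentum_vcoord_enneper :
  arc_up_to_dilation_and_u_translation
    sigma c d enneper_generatrix (Finite 0) p_infty.
Proof.
destruct (Ioo_inhabited c d (proj1 (proj1 Hsigma))) as [s0 H0].
(* [eps] is the sign of [v], which lets the two branches share one argument. *)
assert (Hmain : forall eps, eps * eps = 1 -> 0 < eps * v s0 ->
  arc_up_to_dilation_and_u_translation
    sigma c d enneper_generatrix (Finite 0) p_infty).
{ intros eps Heps Hpos.
  (* [translate_u h] adds [2 h] to [u] and fixes [v], so [h] is half the constant value of
     [u - v^3/3]. *)
  exists eps, ((u s0 - v s0 ^ 3 / 3) / 2); split.
  { intros ->; lra. }
  (* The generatrix is parametrized by its own [v], and the dilation multiplies that by [eps], so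
     the parameter must be [eps * v s]. *)
  intros s Hs; exists (eps * v s); split.
  - split; simpl; [|exact I].
    assert (Hsgn := momentum_vcoord_constant_sign s0 s H0 Hs).
    apply (Rmult_lt_reg_l (eps * v s0)); [exact Hpos|].
    replace (eps * v s0 * (eps * v s)) with (eps * eps * (v s0 * v s)) by ring.
    rewrite Heps; lra.
  - rewrite (momentum_vcoord_cubic_constant s0 s H0 Hs).
    unfold u, v, ucoord, vcoord, translate_u, dilate, enneper_generatrix,
      enneper_profile.
    destruct (sigma s) as [x y]; cbn [fst snd].
    assert (E1 : eps * (eps * (y - x)) = y - x)
      by (rewrite <- Rmult_assoc, Heps; ring).
    assert (E3 : eps * (eps * (y - x)) ^ 3 = (y - x) ^ 3).
    { transitivity ((eps * eps) * (eps * eps) * (y - x) ^ 3); [ring|].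
      rewrite Heps; ring. }
    f_equal; lra. }
destruct (Rdichotomy _ _ (proj1 (momentum_vcoord_velocity s0 H0))) as [H|H].
- apply (Hmain (-1)); lra.
- apply (Hmain 1); lra.
Qed.

End UnitSpeed.

(** * The generatrix and its arc parametrization *)

Lemma is_derive_enneper_x (t : R) :
  is_derive (xcomp enneper_generatrix) t (1 / 2 * (- 1 + t ^ 2)).
Proof.
unfold xcomp, enneper_generatrix, enneper_profile; simpl.
auto_derive; [exact I | field].
Qed.

Lemma is_derive_enneper_y (t : R) :
  is_derive (ycomp enneper_generatrix) t (1 / 2 * (1 + t ^ 2)).
Proof.
unfold ycomp, enneper_generatrix, enneper_profile; simpl.
auto_derive; [exact I | field].
Qed.

Lemma spacelike_enneper :
  spacelike enneper_generatrix (Finite 0) p_infty.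
Proof.
split; [split|].
- exact I.
- intros t _; repeat split.
  + eexists; apply is_derive_enneper_x.
  + apply (ex_derive_ext (fun t => 1 / 2 * (- 1 + t ^ 2))).
    { intros r; symmetry; apply is_derive_unique, is_derive_enneper_x. }
    auto_derive; exact I.
  + eexists; apply is_derive_enneper_y.
  + apply (ex_derive_ext (fun t => 1 / 2 * (1 + t ^ 2))).
    { intros r; symmetry; apply is_derive_unique, is_derive_enneper_y. }
    auto_derive; exact I.
- intros t [Ht _]; simpl in Ht; unfold g, velocity; cbn [fst snd].
  rewrite (is_derive_unique _ _ _ (is_derive_enneper_x t)).
  rewrite (is_derive_unique _ _ _ (is_derive_enneper_y t)).
  (* Difference of the squares of [(1 + t^2) / 2] and [(t^2 - 1) / 2]. *)
  replace (_ + _) with (t * t) by field.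
  now apply Rmult_lt_0_compat.
Qed.

(** The generatrix has speed [t] for [t > 0], so its arc length from [0] is [s = t^2 / 2], whose
    inverse is [sqrt (2 * s)]. *)
Definition enneper_arc (s : R) : L2 := enneper_generatrix (sqrt (2 * s)).

Lemma vcoord_enneper_arc (s : R) : vcoord (enneper_arc s) = sqrt (2 * s).
Proof.
unfold vcoord, enneper_arc, enneper_generatrix, enneper_profile; simpl; field.
Qed.

Lemma sqrt_double_pos (s : R) : 0 < s -> 0 < sqrt (2 * s).
Proof. intros Hs; apply sqrt_lt_R0; lra. Qed.

Lemma is_derive_sqrt_double (s : R) : 0 < s ->
  is_derive (fun s : R => sqrt (2 * s)) s (/ sqrt (2 * s)).
Proof.
intros Hs; assert (Hq := sqrt_double_pos s Hs).
auto_derive; [lra|]. field; lra.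
Qed.

Lemma is_derive_enneper_arc_x (s : R) : 0 < s ->
  is_derive (xcomp enneper_arc) s ((sqrt (2 * s) - / sqrt (2 * s)) / 2).
Proof.
intros Hs; assert (Hq := sqrt_double_pos s Hs).
evar_last.
- apply (is_derive_comp (xcomp enneper_generatrix) (fun s => sqrt (2 * s))).
  + apply is_derive_enneper_x.
  + now apply is_derive_sqrt_double.
- unfold scal; simpl; unfold mult; simpl; field; lra.
Qed.

Lemma is_derive_enneper_arc_y (s : R) : 0 < s ->
  is_derive (ycomp enneper_arc) s ((sqrt (2 * s) + / sqrt (2 * s)) / 2).
Proof.
intros Hs; assert (Hq := sqrt_double_pos s Hs).
evar_last.
- apply (is_derive_comp (ycomp enneper_generatrix) (fun s => sqrt (2 * s))).
  + apply is_derive_enneper_y.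
  + now apply is_derive_sqrt_double.
- unfold scal; simpl; unfold mult; simpl; field; lra.
Qed.

Lemma unit_speed_enneper_arc : unit_speed enneper_arc (Finite 0) p_infty.
Proof.
split; [split|].
- exact I.
- intros s Hs; assert (Hs0 : 0 < s) by exact (proj1 Hs).
  assert (Hq := sqrt_double_pos s Hs0).
  repeat split.
  + eexists; now apply is_derive_enneper_arc_x.
  (* The formula for the first derivative is available only for positive parameters, so it is
     substituted locally. *)
  + apply (ex_derive_ext_loc
             (fun s => (sqrt (2 * s) - / sqrt (2 * s)) / 2)).
    { apply (filter_imp (Ioo (Finite 0) p_infty)).
      - intros t Ht; symmetry; apply is_derive_unique.
        apply is_derive_enneper_arc_x; exact (proj1 Ht).
      - now apply Ioo_locally. }
    auto_derive; repeat split; lra.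
  + eexists; now apply is_derive_enneper_arc_y.
  + apply (ex_derive_ext_loc
             (fun s => (sqrt (2 * s) + / sqrt (2 * s)) / 2)).
    { apply (filter_imp (Ioo (Finite 0) p_infty)).
      - intros t Ht; symmetry; apply is_derive_unique.
        apply is_derive_enneper_arc_y; exact (proj1 Ht).
      - now apply Ioo_locally. }
    auto_derive; repeat split; lra.
- intros s [Hs _]; simpl in Hs; assert (Hq := sqrt_double_pos s Hs).
  unfold g, velocity; cbn [fst snd].
  rewrite (is_derive_unique _ _ _ (is_derive_enneper_arc_x s Hs)).
  rewrite (is_derive_unique _ _ _ (is_derive_enneper_arc_y s Hs)).
  field; lra.
Qed.

Lemma momentum_enneper_arc (s : R) : Ioo (Finite 0) p_infty s ->
  momentum enneper_arc s = vcoord (enneper_arc s).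
Proof.
intros Hs; assert (Hs0 : 0 < s) by exact (proj1 Hs).
rewrite (momentum_unit_speed _ _ _ unit_speed_enneper_arc s Hs).
rewrite (is_derive_unique _ _ _ (is_derive_enneper_arc_x s Hs0)).
rewrite (is_derive_unique _ _ _ (is_derive_enneper_arc_y s Hs0)).
rewrite vcoord_enneper_arc; field.
apply Rgt_not_eq, sqrt_double_pos, Hs0.
Qed.

Lemma arc_parametrization_enneper :
  arc_parametrization enneper_generatrix (Finite 0) p_infty
    enneper_arc (Finite 0) p_infty.
Proof.
split; [exact unit_speed_enneper_arc|].
exists (fun s => sqrt (2 * s)); split.
- intros s [Hs _]; simpl in Hs; assert (Hq := sqrt_double_pos s Hs).
  assert (Hd := is_derive_sqrt_double s Hs).
  repeat split.
  + exact Hq.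
  + eexists; exact Hd.
  + rewrite (is_derive_unique _ _ _ Hd); now apply Rinv_0_lt_compat.
- intros t [Ht _]; simpl in Ht; exists (t * t / 2).
  assert (Htt := Rmult_lt_0_compat t t Ht Ht).
  repeat split; simpl; [lra|].
  replace (2 * (t * t / 2)) with (t * t) by field.
  apply sqrt_square; lra.
Qed.

(** * Curvature from momentum, and uniqueness up to dilation and translation *)

Lemma has_momentum_vcoord_curvature (gamma : R -> L2) (a b : Rbar) :
  has_momentum gamma a b (fun v => v) ->
  has_curvature gamma a b (fun v => 1 / v ^ 2).
Proof.
intros (sigma & c & d & Harc & Hmom).
exists sigma, c, d; split; [exact Harc|].
exact (momentum_vcoord_curvature sigma c d (proj1 Harc) Hmom).
Qed.

Theorem corollary7p1 :
  (spacelike enneper_generatrix (Finite 0) p_infty /\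
   has_momentum enneper_generatrix (Finite 0) p_infty (fun v => v) /\
   has_curvature enneper_generatrix (Finite 0) p_infty (fun v => 1 / v ^ 2)) /\
  (forall (gamma : R -> L2) (a b : Rbar),
     spacelike gamma a b ->
     has_momentum gamma a b (fun v => v) ->
     has_curvature gamma a b (fun v => 1 / v ^ 2) /\
     arc_up_to_dilation_and_u_translation
       gamma a b enneper_generatrix (Finite 0) p_infty).
Proof.
assert (Hmom : has_momentum enneper_generatrix (Finite 0) p_infty (fun v => v)).
{ exists enneper_arc, (Finite 0), p_infty; split.
  - exact arc_parametrization_enneper.
  - exact momentum_enneper_arc. }
split; [split; [exact spacelike_enneper|split; [exact Hmom|]]|].
- now apply has_momentum_vcoord_curvature.
- intros gamma a b _ HK; split; [now apply has_momentum_vcoord_curvature|].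
  destruct HK as (sigma & c & d & [Hunit (phi & Hphi & Hsurj)] & HK).
  destruct (momentum_vcoord_enneper sigma c d Hunit HK) as (l & h & Hl & Harc).
  exists l, h; split; [exact Hl|].
  (* The reparametrization is onto, so every point of [gamma] is a point of [sigma], and the
     inclusion for [sigma] carries over. *)
  intros t Ht; destruct (Hsurj t Ht) as [s [Hs <-]].
  destruct (Hphi s Hs) as (_ & _ & _ & <-).
  exact (Harc s Hs).
Qed.
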